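(* Let $G$ be a finite graph with arbitrary probabilities on its edges, let $0,b\in G$ be two vertices and let $A=\{a_1,a_2,a_3\}\subset G$ be a set of three vertices. For $S\subset\{1,2,3\}$ let $$m_S:=\mathbb{P}\big(b\leftrightarrow a_s\ \text{for all } s\in S,\ \text{and } b\nleftrightarrow a_t\ \text{for all } t\in\{1,2,3\}\setminus S\big).$$ Assume that for some $j\in\{1,2,3\}$ we have $m_{\{j\}}\le m_{\{1,2,3\}\setminus\{j\}}$. Then $$\mathbb{P}(0\leftrightarrow b,\ 0\leftrightarrow A)\ \ge\ \min\{\mathbb{P}(0\leftrightarrow A,\ a\leftrightarrow b): a\in A\}.$$
   Context: A graph is identified with its vertex set. Each edge $e\in E(G)$ carries a number $p(e)\in[0,1]$, and $\omega\subseteq E(G)$ is a random set of edges in which every edge $e$ is included (is ''open'') with probability $p(e)$, independently; $\mathbb{P}$ is the resulting probability measure. $v\leftrightarrow w$ denotes the event that $v$ and $w$ are connected by a path of open edges (or $v=w$), and $v\nleftrightarrow w$ is its complement. For a set of vertices $A$, $v\leftrightarrow A$ means $v\leftrightarrow a$ for some $a\in A$. *)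

(* Defs.v *)
From mathcomp Require Import all_boot all_order all_algebra reals.
Set Implicit Arguments.
Unset Strict Implicit.
Unset Printing Implicit Defensive.
Import Order.TTheory GRing.Theory Num.Theory.
Local Open Scope ring_scope.

Record sgraph := SGraph {
  vertex :> finType;
  adj : rel vertex;
  adj_sym : symmetric adj;
  adj_irrefl : irreflexive adj }.

(* An edge is the two-element set of its endpoints. *)
Definition edges (G : sgraph) : {set {set G}} :=
  [set f | [exists x : G, exists y : G, adj x y && (f == [set x; y])]].

Definition edge_weights (R : realType) (G : sgraph) (p : {set G} -> R) : Prop :=
  forall f, f \in edges G -> 0 <= p f <= 1.

(* The law of the random set w of open edges is the product Bernoulli measure
   on the finite sample space of all subsets of [edges G]; values of [p] outside
   [edges G] are irrelevant. *)
Definition perc_weight (R : realType) (G : sgraph) (p : {set G} -> R)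
    (w : {set {set G}}) : R :=
  \prod_(f in edges G) (if f \in w then p f else 1 - p f).

Definition perc_prob (R : realType) (G : sgraph) (p : {set G} -> R)
    (P : pred {set {set G}}) : R :=
  \sum_(w in powerset (edges G) | P w) perc_weight p w.

(* [connect] is reflexive, so [conn w v v] always holds. *)
Definition conn (G : sgraph) (w : {set {set G}}) (u v : G) : bool :=
  connect [rel x y : G | [set x; y] \in w] u v.

Definition conn_set (G : sgraph) (w : {set {set G}}) (v : G) (A : {set G}) : bool :=
  [exists a in A, conn w v a].

Definition m_prob (R : realType) (G : sgraph) (p : {set G} -> R)
    (b : G) (a : 'I_3 -> G) (S : {set 'I_3}) : R :=
  perc_prob p (fun w =>
    [forall s in S, conn w b (a s)] && [forall t in ~: S, ~~ conn w b (a t)]).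

(* Seeding the fold with [F ord0] makes it the minimum of the values of F. *)
Definition min_ord (R : realType) (n : nat) (F : 'I_n.+1 -> R) : R :=
  \big[Num.min/F ord0]_(i < n.+1) F i.

(* Main.v *)
(* The engine is the van den Berg-Haggstrom-Kahn inequality: conditionally on X
   and Y being disconnected, two events that are increasing in the clusters of X
   and decreasing in those of Y are positively correlated.  It is proved by
   revealing one by one the edges that touch the clusters of X and Y known so
   far: opening such an edge at X amounts, up to raising the functions, to
   conditioning on the clusters of Y avoiding it, which by induction is an event
   favourable to functions of this kind.

   For {i, j, k} = {1, 2, 3} put D_i = P(a_i <-/-> a_j, a_k),
   e_i = m_jk - m_i, q_i = P(o <-> a_i | D_i), q_jk = P(o <-> {a_j, a_k} | D_i).
   Let y_S (resp. x_S) be the probability that b is connected to exactly the a_s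
   with s in S, and that o is connected to some a_t with t outside S (resp. to b).
   The inequality gives
     y_i <= m_i q_jk,   x_jk >= m_jk q_jk,   y_jk <= m_jk q_i,   x_i >= m_i q_i,
   and, comparing D_i and its analogues with the event that a_1, a_2, a_3 are
   pairwise disconnected, q_j + q_k <= q_jk.  Choose i with e_i maximal; it is
   nonnegative by hypothesis.  Then
     (y_i + y_ij + y_ik) - (x_jk + x_j + x_k)
       <= - e_i q_jk + e_k q_k + e_j q_j <= e_i (q_j + q_k - q_jk) <= 0,
   which is the claim with a = a_i. *)
Require Import Defs.
From mathcomp Require Import all_boot all_order all_algebra reals.
From mathcomp Require Import ring lra.
Set Implicit Arguments.
Unset Strict Implicit.
Unset Printing Implicit Defensive.
Import Order.TTheory GRing.Theory Num.Theory.
Local Open Scope ring_scope.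

(** * Connectivity by open edges *)

Lemma conn_sym (G : sgraph) (w : {set {set G}}) : symmetric (conn w).
Proof. by apply: sym_connect_sym => x y /=; rewrite setUC. Qed.

Lemma conn_trans (G : sgraph) (w : {set {set G}}) : transitive (conn w).
Proof. exact: connect_trans. Qed.

Lemma conn_edge (G : sgraph) (w : {set {set G}}) (f : {set G}) (u v : G) :
  f \in edges G -> f \in w -> u \in f -> v \in f -> conn w u v.
Proof.
rewrite inE => /existsP[x /existsP[y /andP[_ /eqP ->]]] fw.
have xy : conn w x y by apply: connect1.
by rewrite !inE => /orP[]/eqP-> /orP[]/eqP->; rewrite // ?(conn_sym w y) //
  /conn connect0.
Qed.

Lemma sub_conn (G : sgraph) (w w' : {set {set G}}) (u v : G) :
  w \subset w' -> conn w u v -> conn w' u v.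
Proof.
move=> ww'; apply: connect_sub => x y /= xy.
by apply: connect1; apply: (subsetP ww').
Qed.

(** Along a path of [w'] from [u], each edge starts at a vertex already reached in [w], so it
    belongs to [w] and the path never leaves the [w]-cluster of [u]. *)
Lemma conn_untouched (G : sgraph) (w w' : {set {set G}}) (u v : G) :
  (forall f z, f \in w' -> z \in f -> conn w u z -> f \in w) ->
  conn w' u v -> conn w u v.
Proof.
move=> ww' /connectP[s]; elim/last_ind: s v => [|s z IH] v /=.
  by move=> _ ->; exact: connect0.
rewrite rcons_path last_rcons => /andP[us lz] ->.
have ul := IH _ us erefl; apply: (conn_trans ul); apply: connect1 => /=.
by apply: ww' lz _ ul; rewrite !inE eqxx.
Qed.

(** * Separation, cluster monotonicity and partially revealed configurations *)

Definition separated (G : sgraph) (X Y : {set G}) (w : {set {set G}}) : bool :=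
  [forall x in X, forall y in Y, ~~ conn w x y].

Lemma separatedP (G : sgraph) (X Y : {set G}) (w : {set {set G}}) :
  reflect (forall x y, x \in X -> y \in Y -> ~~ conn w x y) (separated X Y w).
Proof.
apply: (iffP forall_inP) => [H x y xX yY|H x xX].
  by move/forall_inP: (H x xX); apply.
by apply/forall_inP => y; apply: H.
Qed.

Lemma separatedC (G : sgraph) (X Y : {set G}) (w : {set {set G}}) :
  separated X Y w = separated Y X w.
Proof.
by apply/separatedP/separatedP => H x y xX yY; rewrite conn_sym H.
Qed.

(* Each point of [X] keeps its own cluster, so that connections inside [X] are
   monotone events too; with the cluster of [X] as a whole they would not be. *)
Definition cluster_le (G : sgraph) (X Y : {set G}) (w w' : {set {set G}}) : Prop :=
  (forall x v, x \in X -> conn w x v -> conn w' x v) /\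
  (forall y v, y \in Y -> conn w' y v -> conn w y v).

Definition cluster_mono (R : realType) (G : sgraph) (X Y : {set G})
    (F : {set {set G}} -> R) : Prop :=
  forall w w', cluster_le X Y w w' -> F w <= F w'.

Lemma cluster_monoN (R : realType) (G : sgraph) (X Y : {set G})
    (F : {set {set G}} -> R) :
  cluster_mono X Y F -> cluster_mono Y X (fun w => - F w).
Proof. by move=> mF w w' [H1 H2]; rewrite lerN2; apply: mF. Qed.

(* The expectation of [F] when the edges of [O] are known to be open, those of
   [E] are undecided and all others are known to be closed. *)
Definition cond_exp (R : realType) (G : sgraph) (p : {set G} -> R)
    (E O : {set {set G}}) (F : {set {set G}} -> R) : R :=
  \sum_(w in powerset E)
    (\prod_(f in E) (if f \in w then p f else 1 - p f)) * F (O :|: w).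

Lemma cond_expD1 (R : realType) (G : sgraph) (p : {set G} -> R)
    (E O : {set {set G}}) (F : {set {set G}} -> R) (e : {set G}) : e \in E ->
  cond_exp p E O F =
  p e * cond_exp p (E :\ e) (e |: O) F + (1 - p e) * cond_exp p (E :\ e) O F.
Proof.
move=> eE; rewrite /cond_exp (bigID (fun w : {set {set G}} => e \in w)) /=.
rewrite !mulr_sumr; congr (_ + _).
  rewrite (reindex_onto (fun w => e |: w) (fun w => w :\ e)) /=; last first.
    by move=> w /andP[_ ew]; rewrite setD1K.
  apply: eq_big => [w|w].
    rewrite !powersetE setU11 andbT subUset sub1set eE /=.
    rewrite subsetD1; case: (boolP (w \subset E)) => //= wE.
    apply/eqP/idP => [<-|ew]; first by rewrite !inE eqxx.
    by rewrite setU1K.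
  rewrite !powersetE => /andP[/andP[_ _] /eqP ew].
  rewrite (bigD1 e) //= setU11 setUCA setUA -mulrA.
  congr (_ * (_ * _)); apply: eq_big => [f|f /andP[_ /negPf fe]].
    by rewrite !inE andbC.
  by rewrite !inE fe.
apply: eq_big => [w|w].
  by rewrite !powersetE subsetD1.
move=> /andP[_ /negPf ew]; rewrite (bigD1 e) //= ew -mulrA.
congr (_ * (_ * _)); apply: eq_bigl => f.
by rewrite !inE andbC.
Qed.

Lemma ler_cond_exp (R : realType) (G : sgraph) (p : {set G} -> R)
    (E O : {set {set G}}) (F F' : {set {set G}} -> R) :
  E \subset edges G -> edge_weights p ->
  (forall w : {set {set G}}, w \subset E -> F (O :|: w) <= F' (O :|: w)) ->
  cond_exp p E O F <= cond_exp p E O F'.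
Proof.
move=> EG p01 FF'; apply: ler_sum => w; rewrite powersetE => wE.
apply: ler_wpM2l (FF' _ wE); apply: prodr_ge0 => f fE.
have /andP[p0 p1] := p01 f (subsetP EG _ fE).
by case: ifP; rewrite ?subr_ge0.
Qed.

Lemma cond_exp_mull (R : realType) (G : sgraph) (p : {set G} -> R)
    (E O : {set {set G}}) (F : {set {set G}} -> R) (c : R) :
  cond_exp p E O (fun w => c * F w) = c * cond_exp p E O F.
Proof.
by rewrite /cond_exp mulr_sumr; apply: eq_bigr => w _; rewrite mulrCA.
Qed.

Lemma cond_exp_eq (R : realType) (G : sgraph) (p : {set G} -> R)
    (E O O' : {set {set G}}) (F F' : {set {set G}} -> R) :
  (forall w : {set {set G}}, w \subset E -> F (O :|: w) = F' (O' :|: w)) ->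
  cond_exp p E O F = cond_exp p E O' F'.
Proof.
by move=> FF'; apply: eq_bigr => w; rewrite powersetE => /FF' ->.
Qed.

(** The weights are nonnegative, so a null mean of an indicator kills every weight on its event;
    hence [F] may take either sign. *)
Lemma cond_exp_eq0 (R : realType) (G : sgraph) (p : {set G} -> R)
    (E O : {set {set G}}) (D : pred {set {set G}}) (F : {set {set G}} -> R) :
  E \subset edges G -> edge_weights p ->
  cond_exp p E O (fun w => (D w)%:R) = 0 ->
  cond_exp p E O (fun w => F w * (D w)%:R) = 0.
Proof.
move=> EG p01 /eqP; rewrite psumr_eq0 => [/allP H|w]; last first.
  move=> _; apply: mulr_ge0; last by case: (D _).
  apply: prodr_ge0 => f fE.
  have /andP[p0 p1] := p01 f (subsetP EG _ fE).
  by case: ifP; rewrite ?subr_ge0.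
apply: big1 => w wE; have := H w (mem_index_enum _).
by rewrite wE /= => /eqP H0; rewrite mulrCA H0 mulr0.
Qed.

(** * The van den Berg-Haggstrom-Kahn inequality *)

(** Positive correlation given separation, with denominators cleared so that a null separation event
    needs no exception. *)
Definition pos_corr (R : realType) (G : sgraph) (p : {set G} -> R)
    (X Y : {set G}) (E O : {set {set G}}) : Prop :=
  forall F H : {set {set G}} -> R, cluster_mono X Y F -> cluster_mono X Y H ->
  let mean K := cond_exp p E O (fun w => K w * (separated X Y w)%:R) in
  mean F * mean H <= mean (fun w => F w * H w) * mean (fun=> 1).

(** Negation exchanges the roles of [X] and [Y], and the two signs cancel in both products. *)
Lemma pos_corrC (R : realType) (G : sgraph) (p : {set G} -> R)
    (X Y : {set G}) (E O : {set {set G}}) :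
  pos_corr p X Y E O -> pos_corr p Y X E O.
Proof.
move=> H F K mF mK /=.
have := H _ _ (cluster_monoN mF) (cluster_monoN mK) => /=.
have sC w : separated X Y w = separated Y X w by exact: separatedC.
have N L : cond_exp p E O (fun w => - L w * (separated X Y w)%:R) =
  - cond_exp p E O (fun w => L w * (separated Y X w)%:R).
  rewrite -mulN1r -cond_exp_mull; apply: cond_exp_eq => w _.
  by rewrite sC mulN1r mulNr.
rewrite !N mulrNN.
rewrite (@cond_exp_eq _ _ p E O O (fun w => - F w * - K w * (separated X Y w)%:R)
  (fun w => F w * K w * (separated Y X w)%:R)); last first.
  by move=> w _; rewrite mulrNN sC.
by rewrite (@cond_exp_eq _ _ p E O O (fun w => 1 * (separated X Y w)%:R)
  (fun w => 1 * (separated Y X w)%:R)) // => w _; rewrite sC.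
Qed.

(* Means of [F], [H], [F * H] and [1] over the separation event ([f], [g], [h] and
   [a]), given that an edge of probability [q] is open (index 1) or closed. *)
Lemma mix_corr (R : realType) (q f1 f0 g1 g0 h1 h0 a1 a0 : R) :
  0 <= q <= 1 -> 0 <= a1 -> 0 <= a0 ->
  (a1 = 0 -> [/\ f1 = 0, g1 = 0 & h1 = 0]) ->
  (a0 = 0 -> a1 = 0) -> (a0 = 0 -> [/\ f0 = 0, g0 = 0 & h0 = 0]) ->
  f1 * g1 <= h1 * a1 -> f0 * g0 <= h0 * a0 ->
  f0 * a1 <= f1 * a0 -> g0 * a1 <= g1 * a0 ->
  (q * f1 + (1 - q) * f0) * (q * g1 + (1 - q) * g0) <=
  (q * h1 + (1 - q) * h0) * (q * a1 + (1 - q) * a0).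
Proof.
move=> /andP[q0 q1] a1_ge0 a0_ge0 z1 z01 z0 fg1 fg0 fa ga.
have [a0z|a0n] := eqVneq a0 0.
  have [-> -> ->] := z1 (z01 a0z); have [-> -> ->] := z0 a0z.
  by rewrite !mulr0 addr0 !mul0r.
have a0p : 0 < a0 by rewrite lt_def a0n.
have [a1z|a1n] := eqVneq a1 0.
  have [-> -> ->] := z1 a1z; rewrite a1z !mulr0 !add0r.
  have := ler_wpM2l (sqr_ge0 (1 - q)) fg0; nra.
have a1p : 0 < a1 by rewrite lt_def a1n.
(* After multiplication by [a0 * a1], the bounds on [h1] and [h0] reduce this to nonnegativity of
   [(f1 * a0 - f0 * a1) * (g1 * a0 - g0 * a1)]. *)
have cross : f1 * g0 + f0 * g1 <= h1 * a0 + h0 * a1.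
  rewrite -(ler_pM2r a0p) -(ler_pM2r a1p).
  have := ler_wpM2r (sqr_ge0 a0) fg1; have := ler_wpM2r (sqr_ge0 a1) fg0.
  have : 0 <= (f1 * a0 - f0 * a1) * (g1 * a0 - g0 * a1).
    by apply: mulr_ge0; rewrite subr_ge0.
  nra.
have c1 := ler_wpM2l (sqr_ge0 q) fg1.
have c0 := ler_wpM2l (sqr_ge0 (1 - q)) fg0.
have q1' : 0 <= 1 - q by rewrite subr_ge0.
have cc := ler_wpM2l (mulr_ge0 q0 q1') cross.
nra.
Qed.

(** Condition on the state of [e]. The hypothesis on [E :\ e] handles each state, and [mix_corr]
    joins the two because the conditional means of both functions are larger when [e] is open. *)
Lemma pos_corr_step (R : realType) (G : sgraph) (p : {set G} -> R)
    (p01 : edge_weights p) (X Y : {set G}) (E O : {set {set G}})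
    (e : {set G}) (x u : G) :
  E \subset edges G -> e \in E -> u \in e -> x \in X -> conn O x u ->
  (forall O', pos_corr p X Y (E :\ e) O') -> pos_corr p X Y E O.
Proof.
move=> EG eE ue xX xu IH F K mF mK /=.
have eG : e \in edges G by apply: (subsetP EG).
have EG' : E :\ e \subset edges G by apply: subset_trans EG; apply: subD1set.
(* On configurations where [X] and [Y] are separated, [H] is the indicator that
   they remain so after opening [e]. *)
pose H (w : {set {set G}}) : R := [forall y in Y, forall v in e, ~~ conn w y v]%:R.
have mH : cluster_mono X Y H.
  move=> w w' [_ ww']; rewrite /H ler_nat.
  case: (boolP [forall y in Y, _]) => // /forall_inP Hw.
  rewrite lt0b; apply/forall_inP => y yY; apply/forall_inP => v ve.
  apply/negP => /(ww' _ _ yY); apply/negP.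
  by move/forall_inP: (Hw y yY); apply.
(* Since [e] hangs on the cluster of [X], opening it preserves separation exactly when no endpoint
   of [e] is joined to [Y]. *)
have HD w : separated X Y (e |: (O :|: w)) =
    separated X Y (O :|: w) && [forall y in Y, forall v in e, ~~ conn (O :|: w) y v].
  have sub : O :|: w \subset e |: (O :|: w) by apply: subsetUr.
  apply/separatedP/andP => [S|[/separatedP S /forall_inP T]].
    split.
      by apply/separatedP => z y zX yY; apply: contra (S z y zX yY); apply: sub_conn.
    apply/forall_inP => y yY; apply/forall_inP => v ve.
    apply: contra (S _ _ xX yY) => yv.
    rewrite conn_sym; apply: conn_trans (sub_conn sub yv) _.
    apply: (@conn_trans _ _ u); first by apply: (conn_edge eG); rewrite ?setU11.
    rewrite conn_sym; apply: sub_conn xu; apply: subset_trans sub; exact: subsetUl.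
  move=> z y zX yY; rewrite conn_sym; apply: contra (S _ _ zX yY) => yz.
  rewrite conn_sym; apply: conn_untouched yz => f v.
  rewrite in_setU1 => /orP[/eqP->|//] ve yv.
  by have /forall_inP/(_ v ve) := T y yY; rewrite yv.
have le_e w : separated X Y (e |: (O :|: w)) ->
    cluster_le X Y (O :|: w) (e |: (O :|: w)).
  rewrite HD => /andP[_ /forall_inP T]; split.
    by move=> z v _; apply: sub_conn; apply: subsetUr.
  move=> y v yY; apply: conn_untouched => f z.
  rewrite in_setU1 => /orP[/eqP->|//] ve yv.
  by have /forall_inP/(_ z ve) := T y yY; rewrite yv.
pose m1 L := cond_exp p (E :\ e) (e |: O) (fun w => L w * (separated X Y w)%:R).
pose m0 L := cond_exp p (E :\ e) O (fun w => L w * (separated X Y w)%:R).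
have nneg O' : 0 <= cond_exp p (E :\ e) O' (fun w => 1 * (separated X Y w)%:R).
  rewrite -[X in X <= _](mul0r (cond_exp p (E :\ e) O' (fun=> 1))) -cond_exp_mull.
  by apply: ler_cond_exp => // w _; rewrite mul0r mul1r; case: separated.
have vanish O' L : cond_exp p (E :\ e) O' (fun w => 1 * (separated X Y w)%:R) = 0 ->
    cond_exp p (E :\ e) O' (fun w => L w * (separated X Y w)%:R) = 0.
  move=> z; apply: cond_exp_eq0 => //; rewrite -[RHS]z.
  by apply: cond_exp_eq => w _; rewrite mul1r.
have a1E : m1 (fun=> 1) = m0 H.
  apply: cond_exp_eq => w _; rewrite mul1r -setUA HD /H mulrC.
  by rewrite -natrM mulnb.
(* With [e] closed, [L] and [H] are positively correlated by induction. On the event of [H], opening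
   [e] extends clusters of [X] and leaves those of [Y] alone, so it can only raise [L]. *)
have shift L : cluster_mono X Y L -> m0 L * m1 (fun=> 1) <= m1 L * m0 (fun=> 1).
  move=> mL; rewrite a1E; apply: le_trans (IH O _ _ mL mH) _ => /=.
  apply: ler_wpM2r; first exact: nneg.
  rewrite [leRHS](@cond_exp_eq _ _ p _ _ O _
    (fun w => L (e |: w) * (separated X Y (e |: w))%:R)); last first.
    by move=> w _; rewrite setUA.
  apply: ler_cond_exp => // w _; rewrite -mulrA /H -natrM mulnb andbC -HD.
  case: (boolP (separated X Y (e |: _))) => [/le_e/mL|_]; last by rewrite !mulr0.
  by rewrite !mulr1.
rewrite !(cond_expD1 _ _ _ eE); apply: mix_corr.
- exact: p01.
- exact: nneg.
- exact: nneg.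
- by move=> z; split; apply: vanish.
- by move=> z; change (m1 (fun=> 1) = 0); rewrite a1E; apply: vanish.
- by move=> z; split; apply: vanish.
- exact: IH.
- exact: IH.
- exact: shift.
- exact: shift.
Qed.

(** Induction on the number of undecided edges. When none of them touches the known clusters of [X]
    or [Y], both functions and the separation event are determined, and equality holds. *)
Lemma pos_corr_clusters (R : realType) (G : sgraph) (p : {set G} -> R)
    (p01 : edge_weights p) (X Y : {set G}) (E O : {set {set G}}) :
  E \subset edges G -> pos_corr p X Y E O.
Proof.
have [n] := ubnP #|E|; elim: n E O => // n IH E O En EG.
pose touch (Z : {set G}) (e : {set G}) := [exists u in e, exists x in Z, conn O x u].
have small e : e \in E -> forall O', pos_corr p X Y (E :\ e) O'.
  move=> eE O'; apply: IH.
    by move: En; rewrite (cardsD1 e) eE.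
  by apply: subset_trans EG; apply: subD1set.
have [[e /andP[eE]]|] := altP (@existsP _ (fun e => (e \in E) && touch X e)).
  case/exists_inP => u ue /exists_inP[x xX xu].
  by apply: (pos_corr_step p01 EG eE ue xX xu) => O'; apply: small.
rewrite negb_exists => /forallP noX.
have [[e /andP[eE]]|] := altP (@existsP _ (fun e => (e \in E) && touch Y e)).
  case/exists_inP => u ue /exists_inP[x xX xu]; apply: pos_corrC.
  apply: (pos_corr_step p01 EG eE ue xX xu) => O'; apply: pos_corrC; exact: small.
rewrite negb_exists => /forallP noY F K mF mK /=.
have stay Z (w : {set {set G}}) :
    (forall e, ~~ ((e \in E) && touch Z e)) -> w \subset E ->
    forall x v, x \in Z -> conn (O :|: w) x v = conn O x v.
  move=> noZ wE x v xZ; apply/idP/idP; last by apply: sub_conn; apply: subsetUl.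
  apply: conn_untouched => f z; rewrite inE => /orP[//|fw] zf xz.
  have := noZ f; rewrite (subsetP wE) //= => /exists_inP[].
  by exists z => //; apply/exists_inP; exists x.
have le1 (w : {set {set G}}) : w \subset E ->
    cluster_le X Y (O :|: w) O /\ cluster_le X Y O (O :|: w).
  by move=> wE; split; split=> z v zX; rewrite (stay _ _ _ wE _ _ zX).
have sE (w : {set {set G}}) : w \subset E -> separated X Y (O :|: w) = separated X Y O.
  move=> wE; apply/separatedP/separatedP => S x y xX yY; have := S _ _ xX yY;
  by rewrite (stay _ _ noX wE).
have mE (L : {set {set G}} -> R) : cluster_mono X Y L ->
    forall w : {set {set G}}, w \subset E -> L (O :|: w) = L O.
  move=> mL w wE; have [c1 c2] := le1 w wE.
  by apply/eqP; rewrite eq_le !mL.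
have cE L : (forall w : {set {set G}}, w \subset E -> L (O :|: w) = L O) ->
    cond_exp p E O (fun w => L w * (separated X Y w)%:R) =
    L O * (separated X Y O)%:R * cond_exp p E O (fun=> 1).
  move=> LE; rewrite -cond_exp_mull; apply: cond_exp_eq => w wE.
  by rewrite LE // sE // mulr1.
have mFK (w : {set {set G}}) : w \subset E -> F (O :|: w) * K (O :|: w) = F O * K O.
  by move=> wE; rewrite mE // mE.
rewrite (cE F (mE F mF)) (cE K (mE K mK)) (cE _ mFK) (cE (fun=> 1)) //.
by rewrite le_eqVlt; apply/orP; left; apply/eqP; ring.
Qed.

(** * Correlation inequalities for events *)

Lemma perc_probE (R : realType) (G : sgraph) (p : {set G} -> R)
    (P : pred {set {set G}}) :
  perc_prob p P = cond_exp p (edges G) set0 (fun w => (P w)%:R).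
Proof.
rewrite /perc_prob /cond_exp big_mkcondr; apply: eq_bigr => w _.
by rewrite set0U; case: (P w); rewrite ?mulr1 ?mulr0.
Qed.

Lemma eq_perc_prob (R : realType) (G : sgraph) (p : {set G} -> R)
    (P Q : pred {set {set G}}) : P =1 Q -> perc_prob p P = perc_prob p Q.
Proof. by move=> PQ; apply: eq_bigl => w; rewrite PQ. Qed.

Lemma sub_perc_prob (R : realType) (G : sgraph) (p : {set G} -> R)
    (p01 : edge_weights p) (P Q : pred {set {set G}}) :
  subpred P Q -> perc_prob p P <= perc_prob p Q.
Proof.
move=> PQ; rewrite !perc_probE; apply: ler_cond_exp => // w _.
rewrite ler_nat; have := PQ (set0 :|: w).
by do 2!case: (_ (set0 :|: w)) => //; move=> /(_ isT).
Qed.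

Lemma perc_prob_ge0 (R : realType) (G : sgraph) (p : {set G} -> R)
    (p01 : edge_weights p) (P : pred {set {set G}}) : 0 <= perc_prob p P.
Proof.
rewrite -[X in X <= _](_ : perc_prob p pred0 = 0); first exact: sub_perc_prob.
by rewrite /perc_prob big_pred0 // => w; rewrite andbF.
Qed.

Lemma cond_expD (R : realType) (G : sgraph) (p : {set G} -> R)
    (E O : {set {set G}}) (F F' : {set {set G}} -> R) :
  cond_exp p E O (fun w => F w + F' w) = cond_exp p E O F + cond_exp p E O F'.
Proof. by rewrite -big_split; apply: eq_bigr => w _; rewrite mulrDr. Qed.

Definition event_mono (G : sgraph) (X Y : {set G}) (P : pred {set {set G}}) : Prop :=
  forall w w', cluster_le X Y w w' -> P w -> P w'.

Lemma event_mono_conn (G : sgraph) (X Y : {set G}) (v x : G) :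
  x \in X -> event_mono X Y (fun w => conn w v x).
Proof. by move=> xX w w' [H _]; rewrite !(conn_sym _ v); apply: H. Qed.

Lemma event_monoN (G : sgraph) (X Y : {set G}) (P : pred {set {set G}}) :
  event_mono Y X P -> event_mono X Y (fun w => ~~ P w).
Proof. by move=> mP w w' [H1 H2]; apply: contra; apply: mP. Qed.

Lemma event_monoI (G : sgraph) (X Y : {set G}) (P Q : pred {set {set G}}) :
  event_mono X Y P -> event_mono X Y Q -> event_mono X Y (fun w => P w && Q w).
Proof. by move=> mP mQ w w' ww' /andP[/(mP _ _ ww')-> /(mQ _ _ ww')->]. Qed.

Lemma event_monoU (G : sgraph) (X Y : {set G}) (P Q : pred {set {set G}}) :
  event_mono X Y P -> event_mono X Y Q -> event_mono X Y (fun w => P w || Q w).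
Proof.
by move=> mP mQ w w' ww' /orP[/(mP _ _ ww')->|/(mQ _ _ ww')->]; rewrite ?orbT.
Qed.

Lemma cluster_mono_event (R : realType) (G : sgraph) (X Y : {set G})
    (P : pred {set {set G}}) :
  event_mono X Y P -> cluster_mono X Y (fun w => (P w)%:R : R).
Proof.
move=> mP w w' ww'; rewrite ler_nat; have := mP _ _ ww'.
by case: (P w) => // ->.
Qed.

Lemma perc_prob_pos_corr (R : realType) (G : sgraph) (p : {set G} -> R)
    (p01 : edge_weights p) (X Y : {set G}) (P Q : pred {set {set G}}) :
  event_mono X Y P -> event_mono X Y Q ->
  perc_prob p (fun w => P w && separated X Y w) *
  perc_prob p (fun w => Q w && separated X Y w) <=
  perc_prob p (fun w => P w && Q w && separated X Y w) *
  perc_prob p (separated X Y).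
Proof.
move=> /(@cluster_mono_event R _ _ _ _) mP /(@cluster_mono_event R _ _ _ _) mQ.
have := pos_corr_clusters p01 set0 (subxx (edges G)) mP mQ; rewrite /= !perc_probE.
congr (_ * _ <= _ * _); apply: cond_exp_eq => w _; rewrite -?natrM ?mulnb //.
by rewrite mul1r.
Qed.

(** The complement of [Q] is monotone in the same direction as [P]; subtracting its positive
    correlation with [P] from the total gives the claim. *)
Lemma perc_prob_neg_corr (R : realType) (G : sgraph) (p : {set G} -> R)
    (p01 : edge_weights p) (X Y : {set G}) (P Q : pred {set {set G}}) :
  event_mono X Y P -> event_mono Y X Q ->
  perc_prob p (fun w => P w && Q w && separated X Y w) *
  perc_prob p (separated X Y) <=
  perc_prob p (fun w => P w && separated X Y w) *
  perc_prob p (fun w => Q w && separated X Y w).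
Proof.
move=> mP /event_monoN mQ; have := perc_prob_pos_corr p01 mP mQ.
have split (S : pred {set {set G}}) :
    perc_prob p (fun w => S w && separated X Y w) =
    perc_prob p (fun w => S w && Q w && separated X Y w) +
    perc_prob p (fun w => S w && ~~ Q w && separated X Y w).
  rewrite !perc_probE -cond_expD; apply: cond_exp_eq => w _.
  by rewrite -natrD; case: (S _); case: (Q _); case: separated.
have := split xpredT; rewrite (split P) /= => ->; nra.
Qed.

Lemma event_mono_disconn (G : sgraph) (u v : G) :
  event_mono set0 [set: G] (fun w => ~~ conn w u v).
Proof. by apply/event_monoN/event_mono_conn; rewrite inE. Qed.

(** Harris' inequality for decreasing events, as the case where [X] is empty and [Y] is everything:
    separation is then vacuous. *)
Lemma disconn_pos (R : realType) (G : sgraph) (p : {set G} -> R)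
    (p01 : edge_weights p) (P Q : pred {set {set G}}) :
  event_mono set0 [set: G] P -> event_mono set0 [set: G] Q ->
  0 < perc_prob p P -> 0 < perc_prob p Q ->
  0 < perc_prob p (fun w => P w && Q w).
Proof.
move=> mP mQ P0 Q0; rewrite lt_def perc_prob_ge0 // andbT.
apply: contraTneq (mulr_gt0 P0 Q0) => PQ0; rewrite -leNgt.
have sT w : separated set0 [set: G] w.
  by apply/separatedP => x y; rewrite inE.
have := perc_prob_pos_corr p01 mP mQ.
have sTE S : perc_prob p (fun w => S w && separated set0 [set: G] w) = perc_prob p S.
  by apply: eq_perc_prob => w; rewrite sT andbT.
by rewrite !sTE PQ0 mul0r.
Qed.

(** * Disconnection events of three points and the inequalities between them *)

Definition apart (G : sgraph) (t u v : G) (w : {set {set G}}) : bool :=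
  ~~ conn w t u && ~~ conn w t v.

Lemma apartE (G : sgraph) (t u v : G) (w : {set {set G}}) :
  separated [set t] [set u; v] w = apart t u v w.
Proof.
apply/separatedP/andP => [S|[tu tv] x y].
  by rewrite !S // !inE eqxx ?orbT.
by rewrite !inE => /eqP-> /orP[]/eqP->.
Qed.

(** Given that [t] is separated from [u] and [v], the events [bt] and [ot] are favourable to [t],
    while [buv] and [ouv] are favourable to the other side. So is [uv] to [t], being decreasing in
    the clusters of [u] and [v]; this yields the comparisons with three pairwise disconnected
    points. *)
Lemma apart_bounds (R : realType) (G : sgraph) (p : {set G} -> R)
    (p01 : edge_weights p) (o b t u v : G) :
  let Pr P := perc_prob p (fun w => P w && apart t u v w) in
  let bt w := conn w b t in let ot w := conn w o t in
  let buv w := conn w b u && conn w b v in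
  let ouv w := conn w o u || conn w o v in
  let uv w := ~~ conn w u v in
  let D := perc_prob p (apart t u v) in
  [/\ Pr (fun w => bt w && ouv w) * D <= Pr bt * Pr ouv,
      Pr buv * Pr ouv <= Pr (fun w => buv w && ouv w) * D,
      Pr (fun w => ot w && buv w) * D <= Pr ot * Pr buv &
      Pr bt * Pr ot <= Pr (fun w => bt w && ot w) * D] /\
  [/\ Pr ot * Pr uv <= Pr (fun w => ot w && uv w) * D &
      Pr (fun w => uv w && ouv w) * D <= Pr uv * Pr ouv].
Proof.
move=> Pr bt ot buv ouv uv D.
have mbt : event_mono [set t] [set u; v] bt by apply: event_mono_conn; rewrite !inE.
have mot : event_mono [set t] [set u; v] ot by apply: event_mono_conn; rewrite !inE.
have mbuv : event_mono [set u; v] [set t] buv.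
  by apply: event_monoI; apply: event_mono_conn; rewrite !inE eqxx ?orbT.
have mouv : event_mono [set u; v] [set t] ouv.
  by apply: event_monoU; apply: event_mono_conn; rewrite !inE eqxx ?orbT.
have muv : event_mono [set t] [set u; v] uv.
  by apply/event_monoN/event_mono_conn; rewrite !inE eqxx orbT.
have PrE P : Pr P = perc_prob p (fun w => P w && separated [set t] [set u; v] w).
  by apply: eq_perc_prob => w; rewrite apartE.
have PrE' P : Pr P = perc_prob p (fun w => P w && separated [set u; v] [set t] w).
  by rewrite PrE; apply: eq_perc_prob => w; rewrite separatedC.
have DE : D = perc_prob p (separated [set t] [set u; v]).
  by apply: eq_perc_prob => w; rewrite apartE.
have DE' : D = perc_prob p (separated [set u; v] [set t]).
  by rewrite DE; apply: eq_perc_prob => w; rewrite separatedC.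
split; split.
- by rewrite !PrE DE; apply: perc_prob_neg_corr.
- by rewrite !PrE' DE'; apply: perc_prob_pos_corr.
- by rewrite !PrE DE; apply: perc_prob_neg_corr.
- by rewrite !PrE DE; apply: perc_prob_pos_corr.
- by rewrite !PrE DE; apply: perc_prob_pos_corr.
- by rewrite !PrE DE; apply: perc_prob_neg_corr.
Qed.

Lemma ler_of_ratios (R : realType) (x y m n q d : R) :
  0 < d -> y * d <= m * q -> n * q <= x * d -> y - x <= (m - n) * (q / d).
Proof. by move=> d0 H1 H2; rewrite mulrA ler_pdivlMr //; lra. Qed.

(* For (x, y, z) = (a_i, a_j, a_k): [d], [m], [n], [q] are P(D), m_i, m_jk and the
   unnormalised q of the header; [s] is the probability that the three points are
   pairwise disconnected, and [ry] is that of this event together with o <-> y. *)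
Lemma balance (R : realType) (dx dy dz mx nx my ny mz nz qx qy qz ry rz s
    y1 y2 y3 x1 x2 x3 : R) :
  0 < dx -> 0 < dy -> 0 < dz -> 0 < s -> 0 <= qy -> 0 <= qz ->
  y1 * dx <= mx * qx -> nx * qx <= x1 * dx ->
  y2 * dy <= ny * qy -> my * qy <= x2 * dy ->
  y3 * dz <= nz * qz -> mz * qz <= x3 * dz ->
  qy * s <= ry * dy -> qz * s <= rz * dz -> (ry + rz) * dx <= s * qx ->
  0 <= nx - mx -> ny - my <= nx - mx -> nz - mz <= nx - mx ->
  y1 + y2 + y3 <= x1 + x2 + x3.
Proof.
move=> dx0 dy0 dz0 s0 qy0 qz0 hy1 hx1 hy2 hx2 hy3 hx3 hry hrz hr e0 ey ez.
have e1 := ler_of_ratios dx0 hy1 hx1.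
have e2 := ler_of_ratios dy0 hy2 hx2.
have e3 := ler_of_ratios dz0 hy3 hx3.
have ly : qy / dy <= ry / s by rewrite ler_pdivrMr // mulrAC ler_pdivlMr.
have lz : qz / dz <= rz / s by rewrite ler_pdivrMr // mulrAC ler_pdivlMr.
have lx : ry / s + rz / s <= qx / dx.
  by rewrite -mulrDl ler_pdivrMr // mulrAC ler_pdivlMr // (mulrC qx).
have qdy : 0 <= qy / dy by rewrite divr_ge0 // ltW.
have qdz : 0 <= qz / dz by rewrite divr_ge0 // ltW.
have fy := ler_wpM2r qdy ey; have fz := ler_wpM2r qdz ez.
have fx := ler_wpM2l e0 (le_trans (lerD ly lz) lx).
move: (qy / dy) (qz / dz) (qx / dx) e1 e2 e3 fy fz fx => u v w; lra.
Qed.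

(** Division-free comparison for the degenerate cases: if [d] vanishes, then so does the bound on
    [y]. *)
Lemma ler_of_cross (R : realType) (x y m n q d : R) :
  0 <= d -> 0 <= q -> 0 <= x -> y <= d ->
  y * d <= m * q -> n * q <= x * d -> m <= n -> y <= x.
Proof.
move=> d0 q0 x0 yd H1 H2 mn; have [dz|dn] := eqVneq d 0.
  by apply: le_trans x0; rewrite -dz.
have dp : 0 < d by rewrite lt_def dn.
rewrite -(ler_pM2r dp); apply: le_trans H1 (le_trans _ H2).
exact: ler_wpM2r.
Qed.

(** Cluster representatives turn connectivity patterns into equality patterns, which can be settled
    by case analysis. *)
Lemma conn_root (G : sgraph) (w : {set {set G}}) (u v : G) :
  conn w u v = (fingraph.root [rel x y : G | [set x; y] \in w] u ==
                fingraph.root [rel x y : G | [set x; y] \in w] v).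
Proof. by rewrite root_connect //; exact: conn_sym. Qed.

(** Equality stands for lying in one cluster. If [b] is with [x] but not with [o], the cluster of
    [b] contains [x] alone, or also one of [y], [z]: these are the extra terms on the right. If [b]
    is with [o] but not with [x], it meets [y], [z] or both: the extra terms on the left. Sums on
    both sides avoid truncated subtraction. *)
Lemma apart_count (T : eqType) (o b x y z : T) :
  (([|| o == x, o == y | o == z] && (x == b)) +
   ((b == y) && (b == z) && ((o == y) || (o == z)) && ((x != y) && (x != z))) +
   ((b == y) && (o == y) && ((y != x) && (y != z))) +
   ((b == z) && (o == z) && ((z != x) && (z != y))) <=
   ((o == b) && [|| o == x, o == y | o == z]) +
   ((b == x) && ((o == y) || (o == z)) && ((x != y) && (x != z))) +
   ((o == y) && ((b == x) && (b == z)) && ((y != x) && (y != z))) +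
   ((o == z) && ((b == x) && (b == y)) && ((z != x) && (z != y))))%N.
Proof.
repeat (case: eqVneq => [?|?]; subst; rewrite ?eqxx //=);
by repeat match goal with H : is_true (_ != _) |- _ => move: H end; rewrite ?eqxx.
Qed.

Lemma three_point_bound (R : realType) (G : sgraph) (p : {set G} -> R)
    (p01 : edge_weights p) (o b x y z : G) :
  let oA w := [|| conn w o x, conn w o y | conn w o z] in
  let d t u v := perc_prob p (fun w => (conn w b u && conn w b v) && apart t u v w)
               - perc_prob p (fun w => conn w b t && apart t u v w) in
  0 <= d x y z -> d y x z <= d x y z -> d z x y <= d x y z ->
  perc_prob p (fun w => oA w && conn w x b) <=
  perc_prob p (fun w => conn w o b && oA w).
Proof.
move=> oA d.
have [[y1x x2x _ _] [_ rx]] := apart_bounds p01 o b x y z.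
have [[_ _ y2y x1y] [ry _]] := apart_bounds p01 o b y x z.
have [[_ _ y2z x1z] [rz _]] := apart_bounds p01 o b z x y.
rewrite /d; rewrite [leRHS]mulrC in y2y; rewrite [leRHS]mulrC in y2z.
pose all_apart w := apart x y z w && ~~ conn w y z.
have Zx : perc_prob p (fun w => ~~ conn w y z && apart x y z w) = perc_prob p all_apart.
  by apply: eq_perc_prob => w; rewrite /all_apart andbC.
have Zy : perc_prob p (fun w => ~~ conn w x z && apart y x z w) = perc_prob p all_apart.
  apply: eq_perc_prob => w; rewrite /all_apart /apart (conn_sym w y x).
  by do 3!case: conn.
have Zz : perc_prob p (fun w => ~~ conn w x y && apart z x y w) = perc_prob p all_apart.
  apply: eq_perc_prob => w; rewrite /all_apart /apart !(conn_sym w z).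
  by do 3!case: conn.
move: ry rz rx; rewrite Zx Zy Zz => ry rz rx.
(* When the three points are pairwise disconnected, [o] is joined to at most one of [y] and [z], so
   the two events on the left are disjoint. *)
have RE : perc_prob p (fun w => conn w o y && ~~ conn w x z && apart y x z w) +
          perc_prob p (fun w => conn w o z && ~~ conn w x y && apart z x y w) <=
          perc_prob p (fun w => ~~ conn w y z && (conn w o y || conn w o z)
            && apart x y z w).
  rewrite !perc_probE -cond_expD; apply: ler_cond_exp => // w0 _.
  move: (set0 :|: w0) => w; rewrite -natrD ler_nat /apart.
  rewrite !(conn_sym w z) (conn_sym w y x).
  have := @conn_trans _ w o y z; rewrite (conn_sym w y o).
  by do 5!case: (conn w _ _) => //; move=> /(_ isT isT).
have count :
  perc_prob p (fun w => oA w && conn w x b) +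
  perc_prob p (fun w => conn w b y && conn w b z && (conn w o y || conn w o z)
    && apart x y z w) +
  perc_prob p (fun w => conn w b y && conn w o y && apart y x z w) +
  perc_prob p (fun w => conn w b z && conn w o z && apart z x y w) <=
  perc_prob p (fun w => conn w o b && oA w) +
  perc_prob p (fun w => conn w b x && (conn w o y || conn w o z)
    && apart x y z w) +
  perc_prob p (fun w => conn w o y && (conn w b x && conn w b z) && apart y x z w) +
  perc_prob p (fun w => conn w o z && (conn w b x && conn w b y) && apart z x y w).
  rewrite !perc_probE -!cond_expD; apply: ler_cond_exp => // w0 _.
  move: (set0 :|: w0) => w; rewrite -!natrD ler_nat /oA /apart !conn_root.
  exact: apart_count.
have Zlex : perc_prob p all_apart <= perc_prob p (apart x y z).
  by apply: (sub_perc_prob p01) => w /andP[].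
have Zley : perc_prob p all_apart <= perc_prob p (apart y x z).
  apply: (sub_perc_prob p01) => w; rewrite /all_apart /apart => /andP[/andP[xy xz] yz].
  by rewrite (conn_sym w y x) xy.
have Zlez : perc_prob p all_apart <= perc_prob p (apart z x y).
  apply: (sub_perc_prob p01) => w; rewrite /all_apart /apart => /andP[/andP[xy xz] yz].
  by rewrite !(conn_sym w z) xz.
have small t u v (P : pred {set {set G}}) :
    perc_prob p (fun w => P w && apart t u v w) <= perc_prob p (apart t u v).
  by apply: (sub_perc_prob p01) => w /andP[].
have nneg := perc_prob_ge0 p01.
move=> e0 ey ez.
suff: perc_prob p (fun w => conn w b x && (conn w o y || conn w o z)
    && apart x y z w) +
  perc_prob p (fun w => conn w o y && (conn w b x && conn w b z) && apart y x z w) +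
  perc_prob p (fun w => conn w o z && (conn w b x && conn w b y) && apart z x y w) <=
  perc_prob p (fun w => conn w b y && conn w b z && (conn w o y || conn w o z)
    && apart x y z w) +
  perc_prob p (fun w => conn w b y && conn w o y && apart y x z w) +
  perc_prob p (fun w => conn w b z && conn w o z && apart z x y w).
  by move: count; lra.
(* The ratios q are undefined when [all_apart] is null; by Harris' inequality some
   two of the three points are then almost surely connected. *)
have [Z0|Z_le0] := ltP 0 (perc_prob p all_apart).
  apply: (balance _ _ _ Z0 _ _ y1x x2x y2y x1y y2z x1z ry rz _ e0 ey ez) => //.
  - exact: lt_le_trans Zlex.
  - exact: lt_le_trans Zley.
  - exact: lt_le_trans Zlez.
  - by apply: le_trans rx; apply: ler_wpM2r.
have [xy|xy] := ltP 0 (perc_prob p (fun w => ~~ conn w x y)); last first.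
  have Dx0 : perc_prob p (apart x y z) <= 0.
    by apply: le_trans xy; apply: (sub_perc_prob p01) => w /andP[].
  have Dy0 : perc_prob p (apart y x z) <= 0.
    by apply: le_trans xy; apply: (sub_perc_prob p01) => w /andP[];
      rewrite (conn_sym w y).
  (* Both terms of [d x y z] are null here, so maximality forces [d z x y] to be at most 0. *)
  have dz : perc_prob p (fun w => conn w b x && conn w b y && apart z x y w) <=
            perc_prob p (fun w => conn w b z && apart z x y w).
    have := small x y z (fun w => conn w b y && conn w b z).
    have := nneg (fun w => conn w b x && apart x y z w); lra.
  apply: lerD; first apply: lerD.
  - exact: le_trans (small _ _ _ _) (le_trans Dx0 (nneg _)).
  - exact: le_trans (small _ _ _ _) (le_trans Dy0 (nneg _)).
  - exact: ler_of_cross (nneg _) (nneg _) (nneg _) (small _ _ _ _) y2z x1z dz.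
have [xz|xz] := ltP 0 (perc_prob p (fun w => ~~ conn w x z)); last first.
  have Dx0 : perc_prob p (apart x y z) <= 0.
    by apply: le_trans xz; apply: (sub_perc_prob p01) => w /andP[].
  have Dz0 : perc_prob p (apart z x y) <= 0.
    by apply: le_trans xz; apply: (sub_perc_prob p01) => w /andP[];
      rewrite (conn_sym w z).
  have dy : perc_prob p (fun w => conn w b x && conn w b z && apart y x z w) <=
            perc_prob p (fun w => conn w b y && apart y x z w).
    have := small x y z (fun w => conn w b y && conn w b z).
    have := nneg (fun w => conn w b x && apart x y z w); lra.
  apply: lerD; first apply: lerD.
  - exact: le_trans (small _ _ _ _) (le_trans Dx0 (nneg _)).
  - exact: ler_of_cross (nneg _) (nneg _) (nneg _) (small _ _ _ _) y2y x1y dy.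
  - exact: le_trans (small _ _ _ _) (le_trans Dz0 (nneg _)).
have [yz|yz] := ltP 0 (perc_prob p (fun w => ~~ conn w y z)); last first.
  have Dy0 : perc_prob p (apart y x z) <= 0.
    by apply: le_trans yz; apply: (sub_perc_prob p01) => w /andP[].
  have Dz0 : perc_prob p (apart z x y) <= 0.
    by apply: le_trans yz; apply: (sub_perc_prob p01) => w /andP[];
      rewrite !(conn_sym w z).
  (* Only the terms of [x] survive, and nonnegativity of [d x y z] orders them. *)
  rewrite subr_ge0 in e0; apply: lerD; first apply: lerD.
  - exact: ler_of_cross (nneg _) (nneg _) (nneg _) (small _ _ _ _) y1x x2x e0.
  - exact: le_trans (small _ _ _ _) (le_trans Dy0 (nneg _)).
  - exact: le_trans (small _ _ _ _) (le_trans Dz0 (nneg _)).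
have mono := event_mono_disconn; have := disconn_pos p01 (mono G x y) (mono G x z) xy xz.
move=> /(disconn_pos p01 (event_monoI (mono G x y) (mono G x z)) (mono G y z))/(_ yz).
by rewrite ltNge Z_le0.
Qed.

(** * Translation to indexed points and conclusion *)

Lemma ord3_complements (i : 'I_3) : exists j k : 'I_3,
  [/\ [set~ i] = [set j; k], [set~ j] = [set i; k] & [set~ k] = [set i; j]].
Proof.
pose o0 : 'I_3 := @Ordinal 3 0 isT.
pose o1 : 'I_3 := @Ordinal 3 1 isT.
pose o2 : 'I_3 := @Ordinal 3 2 isT.
have [C0 C1 C2] :
  [/\ [set~ o0] = [set o1; o2], [set~ o1] = [set o0; o2] & [set~ o2] = [set o0; o1]].
  by split; apply/setP => -[[|[|[|n]]] n3]; rewrite !inE.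
case: i => -[|[|[|n]]] n3 //.
- by exists o1, o2; rewrite (_ : Ordinal n3 = o0) //; apply: val_inj.
- exists o0, o2; rewrite (_ : Ordinal n3 = o1); last exact: val_inj.
  by rewrite C0 C1 C2 (setUC [set o0] [set o1]).
- exists o0, o1; rewrite (_ : Ordinal n3 = o2); last exact: val_inj.
  by rewrite C0 C1 C2 (setUC [set o1] [set o2]) (setUC [set o0] [set o2]).
Qed.

(** Once [b] shares the cluster of [a t], avoiding [a u] and [a v] means the same for both. *)
Lemma m_prob1 (R : realType) (G : sgraph) (p : {set G} -> R) (b : G)
    (a : 'I_3 -> G) (t u v : 'I_3) : [set~ t] = [set u; v] ->
  m_prob p b a [set t] =
  perc_prob p (fun w => conn w b (a t) && apart (a t) (a u) (a v) w).
Proof.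
move=> tuv; apply: eq_perc_prob => w; rewrite tuv /apart.
apply/andP/and3P => [[/forall_inP H1 /forall_inP H2]|[bt tu tv]].
  have bt := H1 t (set11 _).
  have N s : s \in [set u; v] -> ~~ conn w (a t) (a s).
    by move=> /H2; apply: contra; apply: conn_trans.
  by split=> //; apply: N; rewrite !inE eqxx ?orbT.
split; apply/forall_inP => s; rewrite !inE; first by move=> /eqP->.
by case/orP => /eqP->; [move: tu|move: tv]; apply: contra; apply: conn_trans;
  rewrite conn_sym.
Qed.

Lemma m_probC1 (R : realType) (G : sgraph) (p : {set G} -> R) (b : G)
    (a : 'I_3 -> G) (t u v : 'I_3) : [set~ t] = [set u; v] ->
  m_prob p b a [set~ t] =
  perc_prob p (fun w => (conn w b (a u) && conn w b (a v)) && apart (a t) (a u) (a v) w).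
Proof.
move=> tuv; apply: eq_perc_prob => w; rewrite setCK tuv /apart.
apply/andP/andP => [[/forall_inP H1 /forall_inP H2]|[/andP[bu bv] /andP[tu _]]].
  have bt := H2 t (set11 _).
  have B s : s \in [set u; v] -> conn w b (a s) && ~~ conn w (a t) (a s).
    move=> /H1 bs; rewrite bs; apply: contra bt => ts; apply: conn_trans bs _.
    by rewrite conn_sym.
  have /B/andP[-> ->] : u \in [set u; v] by rewrite !inE eqxx.
  by have /B/andP[-> ->] : v \in [set u; v] by rewrite !inE eqxx orbT.
split; apply/forall_inP => s; rewrite !inE; first by case/orP => /eqP->.
move=> /eqP->; apply: contra tu; rewrite conn_sym => bt.
exact: conn_trans bt bu.
Qed.

Lemma conn_set3 (G : sgraph) (w : {set {set G}}) (o : G) (a : 'I_3 -> G)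
    (i j k : 'I_3) : [set~ i] = [set j; k] ->
  conn_set w o [set a s | s : 'I_3] =
  [|| conn w o (a i), conn w o (a j) | conn w o (a k)].
Proof.
move=> ijk; apply/exists_inP/or3P => [[_ /imsetP[s _ ->] os]|].
  have [si|si] := eqVneq s i; first by rewrite -si; constructor 1.
  have : s \in [set~ i] by rewrite !inE.
  by rewrite ijk !inE => /orP[]/eqP<-; [constructor 2|constructor 3].
by case=> os; [exists (a i)|exists (a j)|exists (a k)] => //; apply: imset_f.
Qed.

Theorem theorem2 (R : realType) (G : sgraph) (p : {set G} -> R)
    (p01 : edge_weights p) (o b : G)
    (a : 'I_3 -> G) (a_inj : injective a)
    (A : {set G}) (defA : A = [set a i | i : 'I_3])
    (hm : exists j : 'I_3, m_prob p b a [set j] <= m_prob p b a [set~ j]) :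
  perc_prob p (fun w => conn w o b && conn_set w o A) >=
  min_ord (fun i => perc_prob p (fun w => conn_set w o A && conn w (a i) b)).
Proof.
have [j0 hj0] := hm.
pose d j := m_prob p b a [set~ j] - m_prob p b a [set j].
have [i _ dmax] := @arg_maxP _ _ _ j0 xpredT d isT.
have di0 : 0 <= d i by apply: le_trans (dmax j0 isT); rewrite subr_ge0.
have [j [k [Ci Cj Ck]]] := ord3_complements i.
have := @three_point_bound _ _ _ p01 o b (a i) (a j) (a k).
cbv beta zeta; rewrite -!(m_probC1 p b a Ci) -!(m_probC1 p b a Cj) -!(m_probC1 p b a Ck).
rewrite -!(m_prob1 p b a Ci) -!(m_prob1 p b a Cj) -!(m_prob1 p b a Ck).
move=> /(_ di0 (dmax j isT) (dmax k isT)) bound.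
have oA w : conn_set w o A = [|| conn w o (a i), conn w o (a j) | conn w o (a k)].
  by rewrite defA (conn_set3 _ _ _ Ci).
(* The minimum is at most its term at the index [i] maximising [d]. *)
apply: le_trans (bigmin_le_cond _ _ (isT : xpredT i)) _.
under eq_perc_prob do rewrite oA.
by under [leRHS]eq_perc_prob do rewrite oA.
Qed.
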